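(* Let $x\in(0,1)$ and let $\mu^{(x)}$ be the joint distribution of $(\zeta(x),\zeta(1))$ as in the context. Let $z=(z_1,z_2)\in[0,2]^2$ have finite binary expansions $z_1=\sum_{k=1}^m\gamma_k2^{-(k-1)}$ and $z_2=\sum_{k=1}^n\gamma'_k2^{-(k-1)}$ with $\gamma_k,\gamma'_k\in\{0,1\}$, such that the word $\gamma_1\gamma_2\cdots\gamma_m$ is a substring of $\gamma'_1\gamma'_2\cdots\gamma'_n$. Then the local dimension $$\dim_{\mathrm{loc}}(\mu^{(x)},z):=\lim_{r\downarrow0}\frac{\log\mu^{(x)}(B_r(z))}{\log r}$$ exists and equals $2-\frac{\log(1+x)}{\log 2}$, where $B_r(z)$ is the closed Euclidean ball of radius $r$ centred at $z$.
   Context: Let $(Q_n)_{n\ge1}$ be i.i.d. random variables taking values $0$ and $1$ with probability $1/2$ each, and independently let $(U_n)_{n\ge1}$ be i.i.d. uniform on $[0,1]$. For $y\in(0,1]$ let $T_n(y)=\sum_{j=1}^n\mathbbm{1}_{\{U_j\le y\}}$ (with $T_0(y)=0$) and $$\zeta(y)=\sum_{n=1}^\infty(1/2)^{T_{n-1}(y)}Q_n\mathbbm{1}_{\{U_n\le y\}}.$$ In particular $\zeta(1)=\sum_{n\ge1}2^{-(n-1)}Q_n$; each $\zeta(y)$ is uniformly distributed on $[0,2]$. *)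

(* Defs.v *)
From HB Require Import structures.
From mathcomp Require Import all_boot all_order all_algebra.
From mathcomp Require Import all_classical all_reals all_analysis.
Set Implicit Arguments. Unset Strict Implicit. Unset Printing Implicit Defensive.
Import Order.TTheory GRing.Theory Num.Theory.
Import numFieldNormedType.Exports.
Local Open Scope classical_set_scope.
Local Open Scope ring_scope.

Section Defs.
Context {d : measure_display} {T : measurableType d} {R : realType}.

Definition mutually_independent {I : eqType} (P : probability T R)
  (X : I -> T -> R) : Prop :=
  forall (F : seq I) (B : I -> set R),
    uniq F -> (forall i, measurable (B i)) ->
    P (\bigcap_(i in [set` F]) (X i @^-1` B i)) =
    (\prod_(i <- F) P (X i @^-1` B i))%E.

(* Indexing is shifted by one: Q n, U n stand for Q_{n+1}, U_{n+1}. *)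
Definition Tcount (U : nat -> T -> R) (k : nat) (y : R) (w : T) : nat :=
  (\sum_(j < k) nat_of_bool (U j w <= y)%R)%N.

(* zeta(y) = sum_{n>=1} (1/2)^{T_{n-1}(y)} Q_n 1_{U_n <= y}.
   All terms are nonnegative when Q is {0,1}-valued; the series is defined as a
   nonnegative extended-real sum of the positive parts (here the terms as is)
   and then converted back to a real. *)
Definition zeta (Q U : nat -> T -> R) (y : R) (w : T) : R :=
  fine (\sum_(0 <= n <oo)
         (((2^-1) ^+ Tcount U n y w * Q n w * ((U n w <= y)%R : nat)%:R)%R%:E))%E.

End Defs.

Definition binval {R : realType} (g : seq bool) : R :=
  \sum_(k < size g) (nth false g k)%:R / 2 ^+ k.

(* Main.v *)
Require Import Defs.
From HB Require Import structures.
From mathcomp Require Import all_boot all_order all_algebra.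
From mathcomp Require Import all_classical all_reals all_analysis.
From mathcomp Require Import measurable_realfun.
From mathcomp Require Import ring lra.
Import Order.TTheory GRing.Theory Num.Theory.
Import numFieldNormedType.Exports.
Local Open Scope classical_set_scope.
Local Open Scope ring_scope.

(* Write [Z k y] for the variable zeta(y) built from the sequences shifted by k.
   Reading one pair (Q_k, U_k) gives [Z k y = Q_k + Z k.+1 y / 2] if [U_k <= y]
   and [Z k y = Z k.+1 y] otherwise, with (Q_k, U_k) independent of the rest.
   Hence the probability J(A, s) that zeta(x) lies in A and that the digits Q
   start with the word s satisfies
     J(A, q s) = (x J({a | q + a/2 in A}, s) + (1 - x) J(A, s)) / 2.
   On intervals of radius r the dilation doubles r, so each digit multiplies the
   probability by (2 x + (1 - x)) / 2 = (1 + x) / 2, starting from a probability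
   of order r because zeta(x) is uniform.  With words of length N and
   r = 2^-N this gives the order ((1 + x) / 4)^N.  This is an upper bound at
   every point, since zeta(1) determines its first N digits up to boundedly many
   choices; it is a lower bound at z because, with positive probability, exactly
   the occurrence of g inside g' is selected, and from then on all digits are 0. *)

(** * Measurability of the series [zeta] *)

(* Where the sequence diverges, [limn] is the default value 0 of [\bar R]; this
   keeps [zeta] measurable even where Q is not {0,1}-valued. *)
Lemma limn_if_esup {R : realType} (u : (\bar R)^nat) :
  limn u = if limn_esup u == limn_einf u then limn_esup u else 0%E.
Proof.
case: ifPn => [/eqP h|/eqP h].
  apply/cvg_lim => //; rewrite limn_esup_lim in h *.
  apply: (@squeeze_cvge _ _ _ _ (einfs u) _ (esups u)).
  - apply: nearW => n; apply/andP; split.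
      by apply: ereal_inf_lbound; exists n => /=.
    by apply: ereal_sup_ubound; exists n => /=.
  - by rewrite h limn_einf_lim; exact: is_cvg_einfs.
  - exact: is_cvg_esups.
rewrite dvgP // => cu; apply: h.
by rewrite is_cvg_limn_esupE // is_cvg_limn_einfE.
Qed.

(** By [limn_if_esup] the limit is a case distinction on whether limsup and liminf agree, and both
    are measurable, the liminf as minus the limsup of [- f]. *)
Lemma measurable_limn {d} {T : measurableType d} {R : realType}
    (f : (T -> \bar R)^nat) :
  (forall n, measurable_fun setT (f n)) ->
  measurable_fun setT (fun w => limn (f ^~ w)).
Proof.
move=> mf; under eq_fun do rewrite limn_if_esup.
have mN n : measurable_fun setT (fun w => - f n w)%E by exact: measurableT_comp.
have msup := measurable_fun_limn_esup mf.
have minf : measurable_fun setT (fun w => limn_einf (f ^~ w)).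
  rewrite /limn_einf; apply: measurableT_comp => //.
  exact: (measurable_fun_limn_esup mN).
by apply: measurable_fun_ifT => //; exact: measurable_fun_eqe.
Qed.

Lemma measurable_zeta {d} {T : measurableType d} {R : realType}
    (Q U : nat -> T -> R) (y : R) :
  (forall n, measurable_fun setT (Q n)) ->
  (forall n, measurable_fun setT (U n)) ->
  measurable_fun setT (zeta Q U y).
Proof.
move=> mQ mU; rewrite /zeta.
apply: (@measurableT_comp _ _ _ _ _ _ (@fine R)); first exact: fine_measurable.
have mI n : measurable_fun setT (fun w => U n w <= y).
  exact: measurable_fun_ler.
have mif (a b : R) n :
    measurable_fun setT (fun w => if U n w <= y then a else b).
  exact: measurable_fun_ifT.
pose t n w : R := 2^-1 ^+ Tcount U n y w * Q n w * (U n w <= y)%R%:R.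
apply: (@measurable_limn _ _ _ (fun m w => \sum_(0 <= n < m) (t n w)%:E)%E) => m.
apply: emeasurable_sum => n; apply: measurableT_comp => //.
apply: measurable_funM; last first.
  rewrite [X in measurable_fun _ X](_ : _ =
    (fun w => if U n w <= y then 1 else 0)); first exact: mif.
  by apply/funext => w; case: (U n w <= y).
apply: measurable_funM => //.
elim: n => [|n IH].
  by under eq_fun do rewrite /Tcount big_ord0 expr0; exact: measurable_cst.
rewrite (_ : (fun _ => _) = (fun w => 2^-1 ^+ Tcount U n y w *
    (if U n w <= y then 2^-1 else 1))).
  by apply: measurable_funM.
apply/funext => w; rewrite /Tcount big_ord_recr exprD /=.
by case: (U n w <= y); rewrite ?expr1 ?expr0.
Qed.

(** * Bounds and one-step recursion for [zeta] at a fixed outcome *)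

Section pointwise.
Context {d : measure_display} {T : measurableType d} {R : realType}.
Implicit Types (Q U : nat -> T -> R) (y : R) (w : T).

Let term Q U y w n : R :=
  2^-1 ^+ Tcount U n y w * Q n w * (U n w <= y)%R%:R.

Lemma TcountS U n y w : Tcount U n.+1 y w =
  ((U 0%N w <= y)%R + Tcount (fun n => U n.+1) n y w)%N.
Proof. by rewrite /Tcount big_ord_recl. Qed.

(** With c the current power of 1/2, a selected digit adds at most c to the sum and halves c, which
    raises the bound by exactly 2 c - 2 (c / 2) = c. A rejected digit changes neither side. *)
Let sum_term_le Q U y w m : (forall n, 0 <= Q n w <= 1) ->
  \sum_(0 <= n < m) term Q U y w n <= 2 - 2 * 2^-1 ^+ Tcount U m y w.
Proof.
move=> hQ; elim: m => [|m IH].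
  by rewrite big_geq // /Tcount big_ord0 expr0 mulr1 subrr.
rewrite big_nat_recr //=; apply: le_trans (lerD IH (lexx _)) _.
rewrite /term /Tcount big_ord_recr /= exprD -/(Tcount U m y w).
have := hQ m; case: (U m w <= y) => /=; rewrite ?expr1 ?expr0; last first.
  by move=> _; lra.
set c := 2^-1 ^+ _; have : 0 <= c by rewrite exprn_ge0.
nra.
Qed.

Let term_ge0 Q U y w n : (forall n, 0 <= Q n w <= 1) -> 0 <= term Q U y w n.
Proof.
by move=> hQ; rewrite !mulr_ge0 //; have /andP[] := hQ n.
Qed.

Let sum_bounds Q U y w : (forall n, 0 <= Q n w <= 1) ->
  (0 <= \sum_(0 <= n <oo) (term Q U y w n)%:E <= 2%:E)%E.
Proof.
move=> hQ; apply/andP; split.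
  by apply: nneseries_ge0 => n _ _; rewrite lee_fin term_ge0.
apply: lime_le.
  by apply: is_cvg_nneseries => n _ _; rewrite lee_fin term_ge0.
apply: nearW => m; rewrite sumEFin lee_fin.

rewrite (le_trans (sum_term_le Q U y w m hQ)) //.
by rewrite gerBl mulr_ge0 // exprn_ge0.
Qed.

Lemma zeta_bounds Q U y w : (forall n, 0 <= Q n w <= 1) ->
  0 <= zeta Q U y w <= 2.
Proof.
move=> hQ; have /andP[h0 h2] := sum_bounds Q U y w hQ.
rewrite /zeta fine_ge0 //= -lee_fin fineK // ge0_fin_numE //.
by rewrite (le_lt_trans h2) // ltry.
Qed.

(* The self-similarity of the construction: reading (Q_0, U_0) first, a selected
   digit becomes the leading digit and a rejected one leaves no trace. *)
Lemma zeta_step Q U y w : (forall n, 0 <= Q n w <= 1) ->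
  zeta Q U y w =
  let z := zeta (fun n => Q n.+1) (fun n => U n.+1) y w in
  if U 0%N w <= y then Q 0%N w + z / 2 else z.
Proof.
move=> hQ /=.
have hQS n : 0 <= Q n.+1 w <= 1 by [].
have bS := sum_bounds (fun n => Q n.+1) (fun n => U n.+1) y w hQS.
have finS : (\sum_(0 <= n <oo) (term (fun n => Q n.+1) (fun n => U n.+1) y w n)%:E
   \is a fin_num)%E.
  by move/andP: bS => [h0 h2]; rewrite ge0_fin_numE // (le_lt_trans h2) // ltry.
rewrite {1}/zeta nneseries_recl //; last by move=> n _; rewrite lee_fin term_ge0.
rewrite [X in (_ + X)%E](_ : _ = ((2^-1 ^+ (U 0%N w <= y)%R)%:E *
    \sum_(0 <= n <oo) (term (fun n => Q n.+1) (fun n => U n.+1) y w n)%:E)%E);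
    last first.
  rewrite -nneseriesZl; last by move=> n _; rewrite lee_fin term_ge0.
  rewrite -(@nneseries_addn _ (fun n => _ : \bar R) 1); last first.
    by move=> n; rewrite lee_fin term_ge0.
  apply: eq_eseriesr => n _; rewrite addn1 -EFinM /term TcountS exprD.
  by rewrite !mulrA.
rewrite fineD ?fin_numM // fineM //=.
rewrite -/(zeta (fun n => Q n.+1) (fun n => U n.+1) y w).
rewrite /Tcount big_ord0 expr0 mul1r.
by case: (U 0%N w <= y); rewrite ?expr1 ?expr0 ?mulr1 ?mulr0 ?add0r ?mul1r // mulrC.
Qed.

End pointwise.

(** * Independence of disjoint blocks of variables *)

Section independence.
Context {d : measure_display} {T : measurableType d} {R : realType}.
Context {I : eqType} (X : I -> T -> R).
Implicit Types (J : pred I) (F : seq I) (B : I -> set R).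

Definition cylinder F B : set T := \bigcap_(i in [set` F]) (X i @^-1` B i).

(** The pi-system of finite-dimensional cylinders, generating the sigma-algebra of the variables
    with index in [J]. *)
Definition cylinders J : set (set T) :=
  [set E | exists F B, [/\ uniq F, all J F, forall i, measurable (B i) &
                           E = cylinder F B]].

Lemma cylinders_setI J : setI_closed (cylinders J).
Proof.
move=> _ _ [F1 [B1 [u1 J1 m1 ->]]] [F2 [B2 [u2 J2 m2 ->]]].
exists (undup (F1 ++ F2)), (fun i => (if i \in F1 then B1 i else setT) `&`
  (if i \in F2 then B2 i else setT)); split.
- exact: undup_uniq.
- apply/allP => i; rewrite mem_undup mem_cat => /orP[].
    exact: (allP J1).
  exact: (allP J2).
- by move=> i; apply: measurableI; case: ifP.
- apply/seteqP; split => w.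
    move=> [h1 h2] i /= _; split.
      by case: ifPn => // /h1.
    by case: ifPn => // /h2.
  move=> h; split => i /= iF.
    by have := h i; rewrite /= mem_undup mem_cat iF => /(_ isT)[].
  by have := h i; rewrite /= mem_undup mem_cat iF orbT => /(_ isT)[].
Qed.

Lemma measurable_cylinder F B : (forall i, measurable_fun setT (X i)) ->
  (forall i, measurable (B i)) -> measurable (cylinder F B).
Proof.
move=> mX mB; apply: fin_bigcap_measurable; first exact: finite_seq.
by move=> i _; rewrite -[_ @^-1` _]setTI; exact: mX.
Qed.

Lemma cylinders_measurable J : (forall i, measurable_fun setT (X i)) ->
  cylinders J `<=` measurable.
Proof. by move=> mX _ [F [B [_ _ mB ->]]]; exact: measurable_cylinder. Qed.

Lemma cylinders_setT J : cylinders J setT.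
Proof.
exists [::], (fun=> setT); split => //.
by apply/seteqP; split => // w _ i.
Qed.

Lemma measurable_fun_cylinders J i : J i ->
  measurable_fun (setT : set (g_sigma_algebraType (cylinders J))) (X i).
Proof.
move=> Ji _ B mB; rewrite setTI; apply: sub_sigma_algebra.
exists [:: i], (fun=> B); split => //=; first by rewrite Ji.
apply/seteqP; split => w /=.
  by move=> Bw j /=; rewrite inE => /eqP ->.
by move=> /(_ i); apply; rewrite /= inE.
Qed.

Variable P : probability T R.
Hypothesis mX : forall i, measurable_fun setT (X i).
Hypothesis indep : mutually_independent P X.

(** As functions of [E], both sides are finite measures: [P] restricted to the cylinder, and [P]
    scaled by its probability. They agree on a pi-system, hence on the sigma-algebra it
    generates. *)
Lemma independent_sigma J F B E : uniq F -> (forall i, measurable (B i)) ->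
  all (predC J) F -> <<s cylinders J >> E ->
  P (E `&` cylinder F B) = (P (cylinder F B) * P E)%E.
Proof.
move=> uF mB JF.
set S := cylinder F B.
have mS : measurable S by exact: measurable_cylinder.
have r0 : 0 <= fine (P S) by exact: fine_ge0.
have PS : P S = (NngNum r0)%:num%:E by rewrite /= fineK // fin_num_measure.
have -> : P (E `&` S) = mrestr P mS E by [].
have -> : (P S * P E)%E = mscale (NngNum r0) P E by rewrite /mscale -PS.
apply: (@g_sigma_algebra_measure_unique _ _ _ (cylinders J) _ (fun=> setT)).
- exact: cylinders_measurable.
- by move=> _; exact: cylinders_setT.
- by apply/seteqP; split => // w _; exists 0%N.
- exact: cylinders_setI.
- move=> _ [F1 [B1 [u1 J1 m1 ->]]].
  transitivity (P S * P (cylinder F1 B1))%E; last first.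
    exact: (congr1 (fun z => (z * P (cylinder F1 B1))%E) PS).
  rewrite /mrestr /S.
  have FF1 i : i \in F1 -> i \notin F.
    move=> iF1; apply/negP => iF; have /= := allP JF i iF.
    by rewrite (allP J1 i iF1).
  have uFF1 : uniq (F ++ F1).
    by rewrite cat_uniq uF u1 andbT /=; apply/hasPn => i /FF1.
  have mBB1 i : measurable (if i \in F then B i else B1 i) by case: ifP.
  (* As [F] and [F1] are disjoint, one family of sets can follow [B] on [F] and [B1] on [F1], and
     the product over [F ++ F1] splits. *)
  have := indep (F ++ F1) (fun i => if i \in F then B i else B1 i) uFF1 mBB1.
  rewrite big_cat /=.
  rewrite (eq_big_seq (fun i => P (X i @^-1` B i))); last by move=> i ->.
  rewrite [X in (_ * X)%E](eq_big_seq (fun i => P (X i @^-1` B1 i))); last first.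
    by move=> i /FF1/negbTE ->.
  rewrite -!indep // -!/(cylinder _ _) => <-.
  congr (P _); apply/seteqP; split => w.
    move=> [h1 h0] i /=; rewrite mem_cat => iFF.
    case: ifPn => iF; first exact: h0.
    by apply: h1; move: iFF; rewrite (negbTE iF).
  move=> h; split => i /= iF; have := h i; rewrite /= mem_cat iF.
    by rewrite orbT => /(_ isT); rewrite (negbTE (FF1 i iF)).
  by move=> /(_ isT).
- move=> _; have mTS : measurable (setT `&` S) by exact: measurableI.
  by apply: (le_lt_trans (probability_le1 P mTS)); exact: ltry.
Qed.

End independence.

(** * Binary words and the dyadic numbers they represent *)

Section words.
Context {R : realType}.

Lemma binval_nil : binval [::] = 0 :> R.
Proof. by rewrite /binval big_ord0. Qed.

Lemma binval_cons (q : bool) (s : seq bool) :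
  binval (q :: s) = q%:R + binval s / 2 :> R.
Proof.
rewrite /binval big_ord_recl /= expr0 divr1; congr (_ + _).
rewrite mulr_suml; apply: eq_bigr => i _ /=.
by rewrite exprSr invfM mulrA.
Qed.

Lemma binval_cat0 (s : seq bool) N : binval (s ++ nseq N false) = binval s :> R.
Proof.
elim: s => [|q s IH] /=; last by rewrite !binval_cons IH.
by elim: N => [|N IH] //=; rewrite binval_cons IH binval_nil add0r mul0r.
Qed.

Fixpoint word_nat (s : seq bool) : nat :=
  if s is q :: s' then (q * 2 ^ size s' + word_nat s')%N else 0%N.

Lemma word_nat_lt s : (word_nat s < 2 ^ size s)%N.
Proof.
elim: s => //= q s IH; rewrite expnS mul2n -addnn.
by case: q; rewrite ?mul1n ?mul0n ?add0n ?ltn_add2l // ltn_addl.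
Qed.

Lemma word_nat_inj s t : size s = size t -> word_nat s = word_nat t -> s = t.
Proof.
elim: s t => [|q s IH] [|p t] //= [st].
have := word_nat_lt s; have := word_nat_lt t; rewrite st => ht hs.
case: q; case: p; rewrite ?mul1n ?mul0n ?add0n.
- by move=> /addnI /(IH _ st) ->.
- by move=> e; move: ht; rewrite -e ltnNge leq_addr.
- by move=> e; move: hs; rewrite e ltnNge leq_addr.
- by move=> /(IH _ st) ->.
Qed.

Lemma binval_word_nat s : binval s * 2 ^+ size s = 2 * (word_nat s)%:R :> R.
Proof.
elim: s => [|q s IH] /=; first by rewrite binval_nil mul0r mulr0.
rewrite binval_cons exprS natrD natrM natrX.
have -> : (q%:R + binval s / 2) * (2 * 2 ^+ size s) =
    2 * (q%:R * 2 ^+ size s) + binval s * 2 ^+ size s :> R by field.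
by rewrite IH mulrDr.
Qed.

(** Distinct words of length n have values that are distinct multiples of 2 / 2^n, and an interval
    of length 6 / 2^n contains at most four of these. *)
Lemma card_near_words (n : nat) (c : R) :
  (#|[set s : n.-tuple bool | (`|binval s - c| <= 3 / 2 ^+ n)%R]%SET| <= 4)%N.
Proof.
set A := [set s | _]%SET.
have [->|/finset.set0Pn[s1 s1A]] := eqVneq A (@finset.set0 _); first by rewrite cards0.
(* Measured from the smallest word of the set, the integers [word_nat] differ by at most 3, which
   embeds the set into ['I_4]. *)
case: (arg_minnP (fun s : n.-tuple bool => word_nat s) s1A) => s0 s0A s0min.
have s0A' : s0 \in A by [].
have near s : s \in A -> (word_nat s - word_nat s0 < 4)%N.
  move=> sA; rewrite ltnS leq_subLR -(ler_nat R) natrD.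
  move: sA s0A'; rewrite /A /= !inE !ler_distl => /andP[h1 h2] /andP[h3 h4].
  have hs := binval_word_nat s; have hs0 := binval_word_nat s0.
  rewrite !size_tuple in hs hs0.
  have p0 : 0 < 2 ^+ n :> R by rewrite exprn_gt0.
  have : (binval s - binval s0) * 2 ^+ n <= 6 :> R.
    rewrite -ler_pdivlMr //; apply: le_trans (_ : 3 / 2 ^+ n + 3 / 2 ^+ n <= _).
      lra.
    by rewrite -mulrDl; apply: ler_wpM2r; [rewrite invr_ge0 ltW|lra].
  by rewrite mulrBl hs hs0; lra.
rewrite -(@card_in_imset _ _
  (fun s : n.-tuple bool => inord (word_nat s - word_nat s0) : 'I_4)).
  by rewrite (leq_trans (max_card _)) // card_ord.
move=> s t sA tA /(congr1 val) /=; rewrite !inordK ?near // => e.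
apply/val_inj/word_nat_inj; first by rewrite !size_tuple.
by rewrite -(subnK (s0min _ sA)) e subnK // s0min.
Qed.

End words.

(** * Limits, dyadic scales and logarithmic ratios *)

Lemma geometric_bound0 {R : realType} (y q : R) : 0 <= q < 1 ->
  (forall n, `|y| <= q ^+ n) -> y = 0.
Proof.
move=> /andP[q0 q1] h; apply/eqP; rewrite -normr_le0.
have c : q ^+ n @[n --> \oo] --> (0 : R) by apply: cvg_expr; rewrite ger0_norm.
by rewrite -(cvg_lim (@Rhausdorff R) c); apply: limr_ge; [exact: cvgP c|exact: nearW].
Qed.

Lemma dyadic_scale {R : realType} (r : R) : 0 < r <= 1 ->
  exists N, 2^-1 ^+ N.+1 < r <= 2^-1 ^+ N.
Proof.
move=> /andP[r0 r1].
have c : 2^-1 ^+ n @[n --> \oo] --> (0 : R).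
  by apply: cvg_expr; rewrite ger0_norm; lra.
have ex : exists n, 2^-1 ^+ n < r.
  have [n _ h] := cvgr_lt _ c _ r0.
  by exists n; exact: (h n (leqnn n)).
case: (ex_minnP ex) => -[|n] hn nmin.
  by move: hn; rewrite expr0 ltNge r1.
exists n; rewrite hn leNgt; apply/negP => /nmin.
by rewrite ltnn.
Qed.

(** Up to bounded errors, [ln (p r)] is N ln theta and [ln r] is - N ln 2. The errors disappear in
    the quotient because [- ln r] tends to infinity. *)
Lemma cvg_ln_ratio {R : realType} (p : R -> R) (c1 c2 theta : R) :
  0 < c1 -> 0 < c2 -> 0 < theta <= 1 ->
  (forall N r, 2^-1 ^+ N.+1 < r <= 2^-1 ^+ N ->
     c1 * theta ^+ N <= p r <= c2 * theta ^+ N) ->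
  ln (p r) / ln r @[r --> 0^'+] --> - ln theta / ln 2.
Proof.
move=> c10 c20 /andP[t0 t1] hp.
have l2 : 0 < ln 2 :> R by rewrite ln_gt0 // ltr1n.
pose L := - ln theta; have L0 : 0 <= L by rewrite oppr_ge0 ln_le0.
(* [K] bounds [ln (p r) - L / ln 2 * ln r] in absolute value: [L] pays for rounding the scale of [r]
   to an integer N, the logarithms pay for [c1] and [c2], and 1 keeps [K] positive. *)
pose K := L + `|ln c1| + `|ln c2| + 1.
have K0 : 0 < K by rewrite ltr_wpDl // !addr_ge0.
apply/cvgrPdist_le => e e0; near=> r.
have r0 : 0 < r by near: r; exact: nbhs_right_gt.
have r1 : r < 1 by near: r; exact: nbhs_right_lt.
have re : r < expR (- (K / e)) by near: r; apply: nbhs_right_lt; exact: expR_gt0.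
have lr0 : 0 < - ln r by rewrite oppr_gt0 ln_lt0 // r0.
have lre : K / e < - ln r.
  by rewrite ltrNr -(expRK (- (K / e))) ltr_ln ?posrE // expR_gt0.
have [N hN] : exists N, 2^-1 ^+ N.+1 < r <= 2^-1 ^+ N.
  by apply: dyadic_scale; rewrite r0 ltW.
have /andP[p1 p2] := hp N r hN.
have tN : 0 < theta ^+ N by rewrite exprn_gt0.
have pr0 : 0 < p r by apply: lt_le_trans p1; exact: mulr_gt0.
have q1 : ln c1 - L * N%:R <= ln (p r).
  have : ln (c1 * theta ^+ N) <= ln (p r) by rewrite ler_ln ?posrE // mulr_gt0.
  by rewrite lnM ?posrE // lnXn // -mulr_natr /L; lra.
have q2 : ln (p r) <= ln c2 - L * N%:R.
  have : ln (p r) <= ln (c2 * theta ^+ N) by rewrite ler_ln ?posrE // mulr_gt0.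
  by rewrite lnM ?posrE // lnXn // -mulr_natr /L; lra.
have lV2 n : ln (2^-1 ^+ n) = - (ln 2 * n%:R) :> R.
  by rewrite exprVn lnV ?posrE ?exprn_gt0 // lnXn // mulr_natr.
have /andP[r2 r3] := hN.
have s1 : - ln r <= ln 2 * (N%:R + 1).
  have : ln (2^-1 ^+ N.+1) <= ln r by rewrite ler_ln ?posrE ?exprn_gt0 // ltW.
  by rewrite lV2 -natr1; lra.
have s2 : ln 2 * N%:R <= - ln r.
  have : ln r <= ln (2^-1 ^+ N) by rewrite ler_ln ?posrE ?exprn_gt0.
  by rewrite lV2; lra.
have -> : - ln theta / ln 2 - ln (p r) / ln r =
    (ln (p r) - L / ln 2 * ln r) / (- ln r).
  have n2 : ln 2 != 0 :> R by rewrite gt_eqF.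
  have nr : ln r != 0 by rewrite lt_eqF // -oppr_gt0.
  by rewrite /L; field; rewrite n2 nr.
rewrite normrM normfV (gtr0_norm lr0) ler_pdivrMr //.
apply: le_trans (_ : K <= _); last by rewrite mulrC -ler_pdivrMr // ltW.
have D0 : 0 <= L / ln 2 by rewrite divr_ge0 // ltW.
have u1 : L / ln 2 * - ln r <= L * (N%:R + 1).
  by rewrite mulrAC ler_pdivrMr // -mulrA ler_wpM2l // mulrC.
have u2 : L * N%:R <= L / ln 2 * - ln r.
  by rewrite mulrAC ler_pdivlMr // -mulrA ler_wpM2l // mulrC.
have := ler_norm (ln c2); have := ler_norm (- ln c1); rewrite normrN.
have := normr_ge0 (ln c2); have := normr_ge0 (ln c1).
by rewrite /K ler_norml => *; apply/andP; split; lra.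
Unshelve. all: by end_near. Qed.

(** * The shifted process and its events *)

Section process.
Context {d : measure_display} {T : measurableType d} {R : realType}.
Context (P : probability T R) (Q U : nat -> T -> R).
Implicit Types (k : nat) (x y : R) (A B : set R) (s : seq bool) (w : T).

Definition variables (i : nat + nat) : T -> R :=
  match i with inl n => Q n | inr n => U n end.

Definition shifted_zeta (k : nat) (y : R) : T -> R :=
  zeta (fun n => Q (n + k)%N) (fun n => U (n + k)%N) y.

Fixpoint prefix_event (k : nat) (s : seq bool) : set T :=
  if s is q :: s' then Q k @^-1` [set q%:R] `&` prefix_event k.+1 s' else setT.

(** Pointwise facts are proved on this event, which turns out to have probability one. The bound on
    [U n] makes every digit selected when y = 1. *)
Definition good : set T :=
  [set w | forall n, (Q n w = 0 \/ Q n w = 1) /\ U n w <= 1].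

(** The quantity J(A, s) for the sequences shifted by [k], as a real number so that real arithmetic
    applies. *)
Definition joint (k : nat) (x : R) (A : set R) (s : seq bool) : R :=
  fine (P (shifted_zeta k x @^-1` A `&` prefix_event k s)).

Lemma good_Q01 w n : good w -> 0 <= Q n w <= 1.
Proof. by move=> /(_ n)[[->|->] _]; rewrite lexx ler01. Qed.

Lemma shifted_zeta_bounds k y w : good w -> 0 <= shifted_zeta k y w <= 2.
Proof. by move=> gw; apply: zeta_bounds => n; exact: good_Q01. Qed.

Lemma shifted_zeta_step k y w : good w ->
  shifted_zeta k y w = if U k w <= y then Q k w + shifted_zeta k.+1 y w / 2
                       else shifted_zeta k.+1 y w.
Proof.
move=> gw; rewrite /shifted_zeta zeta_step; last by move=> n; exact: good_Q01.
have shE (X : nat -> T -> R) : (fun n => X (n.+1 + k)%N) = (fun n => X (n + k.+1)%N).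
  by apply/funext => n; rewrite addSnnS.
by rewrite !shE.
Qed.

Hypothesis mQ : forall n, measurable_fun setT (Q n).
Hypothesis mU : forall n, measurable_fun setT (U n).

Lemma measurable_shifted_zeta k y : measurable_fun setT (shifted_zeta k y).
Proof. exact: measurable_zeta. Qed.

Lemma measurable_prefix_event k s : measurable (prefix_event k s).
Proof.
elim: s k => [|q s IH] k //=; apply: measurableI => //.
by rewrite -[_ @^-1` _]setTI; exact: mQ.
Qed.

Lemma measurable_joint k x A s : measurable A ->
  measurable (shifted_zeta k x @^-1` A `&` prefix_event k s).
Proof.
move=> mA; apply: measurableI; last exact: measurable_prefix_event.
by rewrite -[_ @^-1` _]setTI; exact: measurable_shifted_zeta.
Qed.

(** * Independence of the pair at time k from the later variables *)

Definition tail (k : nat) (i : nat + nat) : bool :=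
  match i with inl n => (k < n)%N | inr n => (k < n)%N end.

(** The event involves only variables after time k. The measurability proofs are repeated on [T]
    equipped with the sigma-algebra generated by those variables, to which [measurable_zeta] applies
    as well. *)
Lemma joint_tail k x A s : measurable A ->
  <<s cylinders variables (tail k) >>
    (shifted_zeta k.+1 x @^-1` A `&` prefix_event k.+1 s).
Proof.
move=> mA; pose T' := g_sigma_algebraType (cylinders variables (tail k)).
have mQ' n : (k < n)%N -> measurable_fun (setT : set T') (Q n).
  by move=> kn; exact: (@measurable_fun_cylinders _ _ _ _ variables _ (inl n)).
have mU' n : (k < n)%N -> measurable_fun (setT : set T') (U n).
  by move=> kn; exact: (@measurable_fun_cylinders _ _ _ _ variables _ (inr n)).
apply: (@measurableI _ T').
  rewrite -[_ @^-1` _]setTI.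
  have : measurable_fun (setT : set T') (shifted_zeta k.+1 x).
    apply: (@measurable_zeta _ T').
      by move=> n; apply: mQ'; rewrite ltn_addl.
    by move=> n; apply: mU'; rewrite ltn_addl.
  by apply.
suff mpre j : (k < j)%N -> measurable (prefix_event j s : set T') by exact: mpre.
elim: s j => [|q s IH] j kj /=; first exact: (@measurableT _ T').
apply: (@measurableI _ T'); last by apply: IH; rewrite (ltn_trans kj).
by rewrite -[_ @^-1` _]setTI; exact: mQ'.
Qed.

Hypothesis indep : mutually_independent P variables.

Lemma independent_step k x A s (B C : set R) :
  measurable A -> measurable B -> measurable C ->
  fine (P (Q k @^-1` B `&` U k @^-1` C `&`
           (shifted_zeta k.+1 x @^-1` A `&` prefix_event k.+1 s))) =
  fine (P (Q k @^-1` B)) * fine (P (U k @^-1` C)) * joint k.+1 x A s.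
Proof.
move=> mA mB mC.
pose F : seq (nat + nat) := [:: inl k; inr k].
pose BC (i : nat + nat) := match i with inl _ => B | inr _ => C end.
have mBC i : measurable (BC i) by case: i.
have mX i : measurable_fun setT (variables i) by case: i.
have cylE : cylinder variables F BC = Q k @^-1` B `&` U k @^-1` C.
  apply/seteqP; split => w.
    by move=> h; split; [apply: (h (inl k))|apply: (h (inr k))];
      rewrite /= !inE eqxx ?orbT.
  by move=> [h1 h2] i /=; rewrite !inE => /orP[] /eqP ->.
have := @independent_sigma _ _ _ _ _ _ mX indep (tail k) F BC _
  isT mBC _ (joint_tail k x A s mA).
rewrite /= !ltnn => /(_ isT).
rewrite [X in _ = (X * _)%E -> _](indep F BC isT mBC) !big_cons big_nil mule1 /=.
rewrite cylE setIC => ->.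
have fin (X : T -> R) (D : set R) : measurable_fun setT X -> measurable D ->
    P (X @^-1` D) \is a fin_num.
  move=> mX' mD; apply: fin_num_measure.
  by rewrite -[_ @^-1` _]setTI; exact: mX'.
have finE : P (shifted_zeta k.+1 x @^-1` A `&` prefix_event k.+1 s) \is a fin_num.
  by apply: fin_num_measure; exact: measurable_joint.
have [fB fC] := (fin _ B (mQ k) mB, fin _ C (mU k) mC).
by rewrite fineM ?fin_numM // fineM.
Qed.

(** * Laws of the digits and selectors, and the null complement of [good] *)

Hypothesis hQ0 : forall n, P (Q n @^-1` [set 0]) = (2^-1)%:E.
Hypothesis hQ1 : forall n, P (Q n @^-1` [set 1]) = (2^-1)%:E.
Hypothesis hU : forall n (B : set R), measurable B ->
          P (U n @^-1` B) = lebesgue_measure (B `&` `[0, 1]).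

Lemma P_Q n (q : bool) : fine (P (Q n @^-1` [set q%:R])) = 2^-1.
Proof. by case: q; rewrite ?hQ1 ?hQ0. Qed.

Lemma P_U_le n y : 0 <= y <= 1 -> fine (P (U n @^-1` `]-oo, y])) = y.
Proof.
move=> /andP[y0 y1]; rewrite hU //.
rewrite (_ : _ `&` _ = `[0, y]%classic); last first.
  apply/seteqP; split => r /=; rewrite !in_itv /=; first by move=> [-> /andP[->]].
  by move=> /andP[-> ry]; split => //=; exact: le_trans ry _.
by rewrite lebesgue_measure_itv /= lte_fin; case: ltP => //= y0'; lra.
Qed.

Lemma P_U_gt n y : 0 <= y <= 1 -> fine (P (U n @^-1` `]y, +oo[)) = 1 - y.
Proof.
move=> h; rewrite (_ : U n @^-1` `]y, +oo[ = ~` (U n @^-1` `]-oo, y])).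
  rewrite probability_setC; last first.
    by rewrite -[_ @^-1` _]setTI; exact: mU.
  rewrite fineB // ?P_U_le //.
  apply: fin_num_measure; by rewrite -[_ @^-1` _]setTI; exact: mU.
by rewrite preimage_setC setCitvl.
Qed.

Lemma not_goodE : ~` good = \bigcup_n (~` (Q n @^-1` [set 0] `|` Q n @^-1` [set 1])
    `|` U n @^-1` `]1, +oo[).
Proof.
rewrite -[RHS]setCK setC_bigcup; congr (~` _); apply/seteqP; split => w.
  move=> gw n _ /=; have [h1 h2] := gw n.
  by move=> [/(_ h1)//|]; rewrite in_itv /= andbT ltNge h2.
move=> h n; have {h} := h n I => /not_orP[/notP h1 h2]; split => //.
by move: h2; rewrite /= in_itv /= andbT => /negP; rewrite -leNgt.
Qed.

Let mQn n (B : set R) : measurable B -> measurable (Q n @^-1` B).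
Proof. by move=> mB; rewrite -[_ @^-1` _]setTI; exact: mQ. Qed.

Let mUn n (B : set R) : measurable B -> measurable (U n @^-1` B).
Proof. by move=> mB; rewrite -[_ @^-1` _]setTI; exact: mU. Qed.

Let mbad n : measurable (~` (Q n @^-1` [set 0] `|` Q n @^-1` [set 1])
    `|` U n @^-1` `]1, +oo[).
Proof.
apply: measurableU; last exact: mUn.
by apply: measurableC; apply: measurableU; exact: mQn.
Qed.

Lemma measurable_not_good : measurable (~` good).
Proof. by rewrite not_goodE; exact: bigcup_measurable. Qed.

Lemma P_not_good : P (~` good) = 0%E.
Proof.
apply/eqP; rewrite -measure_le0 not_goodE.
have mB : measurable (\bigcup_n (~` (Q n @^-1` [set 0] `|` Q n @^-1` [set 1])
    `|` U n @^-1` `]1, +oo[)) by exact: bigcup_measurable.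
apply: (le_trans (measure_sigma_subadditive P mbad mB (@subset_refl _ _))).
rewrite eseries0 // => n _ _.
apply/eqP; rewrite -measure_le0.
have mQ01 : measurable (Q n @^-1` [set 0] `|` Q n @^-1` [set 1]).
  by apply: measurableU; exact: mQn.
have mQ01C := measurableC mQ01.
set V := U n @^-1` `]1, +oo[; have mV : measurable V by exact: mUn.
have leU : (P (~` (Q n @^-1` [set 0%R] `|` Q n @^-1` [set 1%R]) `|` V)
    <= P (~` (Q n @^-1` [set 0%R] `|` Q n @^-1` [set 1%R])) + P V)%E.
  exact: measureU2.
apply: (le_trans leU).
have PU : P (Q n @^-1` [set 0] `|` Q n @^-1` [set 1]) = (2^-1 + 2^-1)%:E.
  rewrite EFinD -{1}(hQ0 n) -(hQ1 n); apply: measureU; try exact: mQn.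
  by apply/seteqP; split => // w /= [-> /eqP]; rewrite eq_sym oner_eq0.
have fU : P V \is a fin_num by exact: fin_num_measure.
rewrite probability_setC // PU -(fineK fU) P_U_gt; last by rewrite ler01 lexx.
by rewrite -EFinB -EFinD lee_fin; lra.
Qed.

(** Outcomes outside [good] form a null set, so adding them to [B] costs nothing. *)
Lemma ae_fine_le (A B : set T) : measurable A -> measurable B ->
  (forall w, good w -> A w -> B w) -> fine (P A) <= fine (P B).
Proof.
move=> mA mB AB; apply: fine_le; try exact: fin_num_measure.
have mg := measurable_not_good.
apply: (@le_trans _ _ (P (B `|` ~` good))).
  apply: le_measure; rewrite ?inE //; first exact: measurableU.
  move=> w Aw; have [gw|] := pselect (good w); last by right.
  by left; exact: AB.
have leU : (P (B `|` ~` good) <= P B + P (~` good))%E by exact: measureU2.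
by rewrite (le_trans leU) // P_not_good adde0.
Qed.

Lemma ae_fine_eq (A B : set T) : measurable A -> measurable B ->
  (forall w, good w -> A w <-> B w) -> fine (P A) = fine (P B).
Proof.
move=> mA mB AB; apply/eqP; rewrite eq_le.
by rewrite !ae_fine_le // => w gw; rewrite AB.
Qed.

Lemma fine_P_split (A B : set T) : measurable A -> measurable B ->
  fine (P A) = fine (P (A `&` B)) + fine (P (A `&` ~` B)).
Proof.
move=> mA mB; have mBC := measurableC mB.
rewrite -fineD ?fin_num_measure //; try exact: measurableI.
rewrite -measureU; [|exact: measurableI|exact: measurableI|]; last first.
  by rewrite setIACA setICr setI0.
by rewrite -setIUr setUCr setIT.
Qed.

(** * The recursion for [joint] and its elementary consequences *)

Lemma joint_cons k x (q : bool) s (A : set R) : 0 <= x <= 1 -> measurable A ->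
  joint k x A (q :: s) =
  2^-1 * (x * joint k.+1 x [set a | A (q%:R + a / 2)] s
          + (1 - x) * joint k.+1 x A s).
Proof.
move=> hx mA.
have mA' : measurable [set a | A (q%:R + a / 2)].
  have mf : measurable_fun setT (fun a : R => q%:R + a / 2).
    by apply: measurable_funD => //; apply: measurable_funM.
  by rewrite (_ : [set _ | _] = setT `&` (fun a : R => q%:R + a / 2) @^-1` A);
    [exact: mf|rewrite setTI].
have mJ B t : measurable B -> measurable (shifted_zeta k.+1 x @^-1` B `&`
    prefix_event k.+1 t) by exact: measurable_joint.
have mle : measurable (U k @^-1` `]-oo, x]) by exact: mUn.
(* Split on whether digit k is selected. On each half [shifted_zeta_step] gives an event at shift k
   + 1, to which [independent_step] applies. *)
rewrite /joint (fine_P_split _ (U k @^-1` `]-oo, x])) //; last exact: measurable_joint.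
have mq := @measurable_set1 R q%:R.
have E1 := independent_step k x _ s _ _ mA' mq (@measurable_itv R `]-oo, x]).
have E2 := independent_step k x _ s _ _ mA mq (@measurable_itv R `]x, +oo[).
rewrite P_Q P_U_le // in E1; rewrite P_Q P_U_gt // in E2.
rewrite mulrDr !mulrA -E1 -E2; congr (_ + _).
- apply: ae_fine_eq.
  + by apply: measurableI => //; exact: measurable_joint.
  + by apply: measurableI; [apply: measurableI; [exact: mQn|exact: mUn]|exact: mJ].
  + move=> w gw /=; rewrite in_itv /= shifted_zeta_step //.
    split; first by move=> [[hA [hq hs]] hx']; rewrite hx' hq in hA.
    by move=> [[-> hx'] [hA hs]]; rewrite hx'.
- apply: ae_fine_eq.
  + by apply: measurableI; [exact: measurable_joint|exact: measurableC].
  + by apply: measurableI; [apply: measurableI; [exact: mQn|exact: mUn]|exact: mJ].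
  + move=> w gw /=; rewrite !in_itv /= andbT shifted_zeta_step // ltNge.
    split; first by move=> [[hA [hq hs]] /negP hx']; rewrite (negbTE hx') in hA.
    by move=> [[-> hx'] [hA hs]]; rewrite (negbTE hx'); split => //; exact/negP.
Qed.

(** The recursion consumes a digit, so the empty word is first split according to the value of digit
    k. *)
Lemma joint_nil k x A : measurable A ->
  joint k x A [::] = joint k x A [:: false] + joint k x A [:: true].
Proof.
move=> mA; have mQ0 := mQn k [set 0] (measurable_set1 0).
rewrite /joint (fine_P_split _ (Q k @^-1` [set 0])) //; last exact: measurable_joint.
congr (_ + _); apply: ae_fine_eq; try exact: measurable_joint.
- by apply: measurableI => //; exact: measurable_joint.
- by move=> w gw /=; tauto.
- by apply: measurableI; [exact: measurable_joint|exact: measurableC].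
- move=> w gw /=; have [[h|h] _] := gw k; rewrite h.
    by split=> [[_ []]//|[_ [/esym/eqP]]]; rewrite oner_eq0.
  split=> [[[? _] _]//|[? _]]; split => //.
  by apply/eqP; rewrite oner_eq0.
Qed.

Lemma joint_ge0 k x A s : 0 <= joint k x A s.
Proof. exact: fine_ge0. Qed.

Lemma joint_le k x A B s : measurable A -> measurable B ->
  (forall a, 0 <= a <= 2 -> A a -> B a) -> joint k x A s <= joint k x B s.
Proof.
move=> mA mB AB; apply: ae_fine_le; [exact: measurable_joint..|].
by move=> w gw [/= Aw ?]; split => //=; apply: AB => //; exact: shifted_zeta_bounds.
Qed.

Let measurable_le (t : R) : measurable [set a : R | a <= t].
Proof.
by rewrite (_ : [set a | a <= t] = `]-oo, t]%classic) //;
  apply/seteqP; split => a /=; rewrite in_itv.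
Qed.

Let measurable_near (c r : R) : measurable [set a : R | `|a - c| <= r].
Proof.
rewrite (_ : [set a | _] = `[c - r, c + r]%classic) //.
by apply/seteqP; split => a /=; rewrite in_itv /= ler_distl.
Qed.

Lemma joint_le0 k x t s : t < 0 -> joint k x [set a | a <= t] s = 0.
Proof.
move=> t0; rewrite /joint.
rewrite (ae_fine_eq _ set0) ?measure0 //; first exact: measurable_joint.
move=> w gw; split => // -[/= h _].
have /andP[h0 _] := shifted_zeta_bounds k x w gw.
by have := le_lt_trans (le_trans h0 h) t0; rewrite ltxx.
Qed.

Lemma joint_ge2 k x t : 2 <= t -> joint k x [set a | a <= t] [::] = 1.
Proof.
move=> t2; rewrite /joint.
rewrite (ae_fine_eq _ setT) ?probability_setT //; first exact: measurable_joint.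
move=> w gw; split => // _; split => //=.
by have /andP[_ h2] := shifted_zeta_bounds k x w gw; exact: le_trans h2 t2.
Qed.

Lemma joint_scale k x (q : bool) t s :
  joint k x [set a | q%:R + a / 2 <= t] s = joint k x [set a | a <= 2 * (t - q%:R)] s.
Proof.
by congr (joint _ _ _ _); apply/seteqP; split => a /= h; lra.
Qed.

(** * The uniform law and the growth of [joint] along words *)

Section fixed_x.
Context (x : R).
Hypothesis hx : 0 < x < 1.

Let hx' : 0 <= x <= 1.
Proof. by case/andP: hx => *; apply/andP; split; exact: ltW. Qed.

Definition uniform_cdf02 (t : R) : R :=
  if t <= 0 then 0 else if 2 <= t then 1 else t / 2.

(* The distribution function and the uniform one satisfy the same recursion;
   of the two dilated terms on its right-hand side one is always equal to 0
   or 1, so that the distance between the two functions contracts. *)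
Lemma shifted_zeta_cdf k t :
  joint k x [set a | a <= t] [::] = uniform_cdf02 t.
Proof.
have /andP[x0 x1] := hx.
apply/eqP; rewrite -subr_eq0; apply/eqP.
(* The rate is x / 2 + (1 - x): one dilated term is exact, the other carries weight x / 2, and the
   two undilated terms together carry 1 - x. *)
apply: (@geometric_bound0 _ _ (1 - x / 2)); first by apply/andP; split; lra.
move=> n; elim: n k t => [|n IH] k t.
  rewrite expr0; have h0 := joint_ge0 k x [set a | a <= t] [::].
  have h1 : joint k x [set a | a <= t] [::] <= 1.
    by rewrite -(joint_ge2 k x 2 (lexx _)); apply: joint_le => // a /andP[].
  by rewrite /uniform_cdf02; case: (leP t 0) => ?; [|case: (leP 2 t) => ?];
    rewrite ler_norml; apply/andP; split; lra.
rewrite joint_nil // !joint_cons // !joint_scale /= subr0.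
set e := (1 - x / 2) ^+ n in IH *.
have e0 : 0 <= e by rewrite exprn_ge0 //; lra.
have := IH k.+1 t; rewrite ler_norml => /andP[l1 l2].
rewrite exprS -/e.
have [t1|t1] := ltP t 1.
  rewrite (joint_le0 k.+1 x (2 * (t - 1))); last lra.
  have := IH k.+1 (2 * t); rewrite ler_norml => /andP[].
  move: l1 l2; move: (joint _ _ _ _) (joint _ _ _ _) => F1 F2.
  rewrite /uniform_cdf02.
  case: (leP t 0) => ?; case: (leP (2 * t) 0) => ?; try lra;
  case: (leP 2 t) => ?; try lra; case: (leP 2 (2 * t)) => ?; try lra;
  move=> *; rewrite ler_norml; apply/andP; split; nra.
rewrite (joint_ge2 k.+1 x (2 * t)); last lra.
have := IH k.+1 (2 * (t - 1)); rewrite ler_norml => /andP[].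
move: l1 l2; move: (joint _ _ _ _) (joint _ _ _ _) => F1 F2.
rewrite /uniform_cdf02.
case: (leP t 0) => ?; try lra; case: (leP (2 * (t - 1)) 0) => ?;
case: (leP 2 t) => ?; try lra; case: (leP 2 (2 * (t - 1))) => ?; try lra;
move=> *; rewrite ler_norml; apply/andP; split; nra.
Qed.

Lemma joint_near_nil_le k c r : 0 < r ->
  joint k x [set a | `|a - c| <= r] [::] <= 3 / 2 * r.
Proof.
move=> r0.
have -> : 3 / 2 * r = joint k x [set a | `|a - c| <= r] [::] + (3 / 2 * r -
  joint k x [set a | `|a - c| <= r] [::]) by ring.
rewrite lerDl subr_ge0.
have mJ B : measurable B -> measurable (shifted_zeta k x @^-1` B `&`
    prefix_event k [::]) by exact: measurable_joint.
(* Cutting at [c - 2 * r] instead of [c - r] keeps the closed interval disjoint from the half-line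
   even if its left endpoint has mass. The price is a length 3 r, hence the constant 3 / 2. *)
have split : joint k x [set a | a <= c - 2 * r] [::] +
    joint k x [set a | `|a - c| <= r] [::] <= joint k x [set a | a <= c + r] [::].
  rewrite {3}/joint (fine_P_split _ (shifted_zeta k x @^-1` [set a | a <= c - 2 * r]
    `&` prefix_event k [::])); [|exact: mJ..].
  apply: lerD; apply: ae_fine_le; try exact: mJ.
  - by apply: measurableI; exact: mJ.
  - by move=> w _ /= [h _]; repeat split => //; lra.
  - by apply: measurableI; [exact: mJ|apply: measurableC; exact: mJ].
  - move=> w _ /=; rewrite ler_distl => -[/andP[h1 h2] _].
    by split; [split=> //; lra|move=> [h _]; lra].
rewrite !shifted_zeta_cdf in split.
apply: le_trans (_ : uniform_cdf02 (c + r) - uniform_cdf02 (c - 2 * r) <= _).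
  by rewrite lerBrDl.
rewrite /uniform_cdf02.
case: (leP (c + r) 0) => ?; case: (leP (c - 2 * r) 0) => ?;
case: (leP 2 (c + r)) => ?; case: (leP 2 (c - 2 * r)) => ?; lra.
Qed.

(** The centre must be arbitrary for the induction, since a selected digit q moves it from c to 2 (c
    - q) while doubling the radius. *)
Lemma joint_near_le k c r s : 0 < r ->
  joint k x [set a | `|a - c| <= r] s <= 3 / 2 * r * ((1 + x) / 2) ^+ size s.
Proof.
have /andP[x0 x1] := hx.
elim: s k c r => [|q s IH] k c r r0.
  by rewrite expr0 mulr1; exact: joint_near_nil_le.
rewrite joint_cons //= exprS.
have h1 : joint k.+1 x [set a | `|q%:R + a / 2 - c| <= r] s <=
    3 / 2 * (2 * r) * ((1 + x) / 2) ^+ size s.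
  apply: le_trans (IH k.+1 (2 * (c - q%:R)) (2 * r) _); last lra.
  apply: joint_le => //.
    rewrite (_ : [set _ | _] = [set a | `|a - 2 * (c - q%:R)| <= 2 * r]) //.
    by apply/seteqP; split => a /=; rewrite !ler_distl => /andP[? ?];
      apply/andP; split; lra.
  by move=> a _ /=; rewrite !ler_distl => /andP[? ?]; apply/andP; split; lra.
have h2 := IH k.+1 c r r0.
move: h1 h2; set e := _ ^+ _; set j1 := joint _ _ _ _; set j2 := joint _ _ _ _.
move=> h1 h2.
have : x * j1 <= x * (3 / 2 * (2 * r) * e) by rewrite ler_pM2l.
have : (1 - x) * j2 <= (1 - x) * (3 / 2 * r * e) by apply: ler_wpM2l => //; lra.
lra.
Qed.

(** A selected zero only doubles [r]. The condition on [r] keeps the interval inside [0, 2] through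
    all N doublings, so the uniform law gives exactly half its length at the end. *)
Lemma joint_zeros_ge k r N : 0 < r -> r * 2 ^+ N <= 2 ->
  r / 2 * ((1 + x) / 2) ^+ N <= joint k x [set a | a <= r] (nseq N false).
Proof.
have /andP[x0 x1] := hx.
elim: N k r => [|N IH] k r r0 rN.
  rewrite /= shifted_zeta_cdf /uniform_cdf02; move: rN; rewrite !expr0 => rN.
  by case: (leP r 0) => ?; case: (leP 2 r) => ?; lra.
rewrite /= joint_cons // joint_scale subr0 exprS.
have rN2 : 2 * r * 2 ^+ N <= 2 by move: rN; rewrite exprS; lra.
have h1 := IH k.+1 (2 * r) _ rN2.
have h2 : r / 2 * ((1 + x) / 2) ^+ N <= joint k.+1 x [set a | a <= r] (nseq N false).
  apply: IH => //; apply: le_trans rN2; rewrite -mulrA ler_peMl ?ler1n //.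
  by rewrite mulr_ge0 ?exprn_ge0 // ltW.
have {}h1 := h1 (mulr_gt0 (ltr0Sn _ 1) r0).
move: h1 h2; set e := _ ^+ _; set j1 := joint _ _ _ _; set j2 := joint _ _ _ _.
move=> h1 h2.
have : x * (2 * r / 2 * e) <= x * j1 by rewrite ler_pM2l.
have : (1 - x) * (r / 2 * e) <= (1 - x) * j2 by apply: ler_wpM2l => //; lra.
lra.
Qed.

(** * Lower bounds for words that contain [g] *)

Let m := x * (1 - x) / 2.

Let m_gt0 : 0 < m.
Proof. by have /andP[x0 x1] := hx; rewrite divr_gt0 // mulr_gt0 // subr_gt0. Qed.

(** A given letter is read and selected with probability x / 2, read and rejected with probability
    (1 - x) / 2. With [m] below both, every letter of [g'] costs the same factor. *)
Let m_le_select : m <= x / 2.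
Proof.
by rewrite /m; have := sqr_ge0 x; rewrite expr2; lra.
Qed.

Let m_le_skip : m <= (1 - x) / 2.
Proof.
by rewrite /m; have := sqr_ge0 (1 - x); rewrite expr2; lra.
Qed.

(** Only the branch of the recursion that rejects every letter of [p] is kept. *)
Lemma joint_skip_ge k A p s : measurable A ->
  m ^+ size p * joint (k + size p) x A s <= joint k x A (p ++ s).
Proof.
move=> mA; have /andP[x0 x1] := hx.
elim: p k => [|q p IH] k /=; first by rewrite expr0 mul1r addn0.
rewrite joint_cons // exprS -mulrA addnS -addSn.
apply: le_trans (ler_wpM2l _ (IH k.+1)) _; first exact: ltW.
apply: le_trans (ler_wpM2r (joint_ge0 k.+1 x A (p ++ s)) m_le_skip) _.
have := mulr_ge0 (ltW x0) (joint_ge0 k.+1 x [set a | A (q%:R + a / 2)] (p ++ s)).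
lra.
Qed.

(** Only the branch that selects every letter of [g] is kept. There the interval pulls back to one
    of radius 2 r around the value of the remaining word, which contains that of radius r. *)
Lemma joint_select_ge k (g : seq bool) r s : 0 <= r ->
  m ^+ size g * joint (k + size g) x [set a | `|a - 0| <= r] s <=
  joint k x [set a | `|a - binval g| <= r] (g ++ s).
Proof.
move=> r0; have /andP[x0 x1] := hx.
elim: g k => [|q g IH] k /=; first by rewrite expr0 mul1r addn0 binval_nil.
rewrite joint_cons // exprS -mulrA addnS -addSn.
apply: le_trans (ler_wpM2l _ (IH k.+1)) _; first exact: ltW.
have h : joint k.+1 x [set a | `|a - binval g| <= r] (g ++ s) <=
    joint k.+1 x [set a | `|q%:R + a / 2 - binval (q :: g)| <= r] (g ++ s).
  apply: joint_le => //.
    rewrite (_ : [set _ | _] = [set a | `|a - binval g| <= 2 * r]) //.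
    by apply/seteqP; split => a /=; rewrite !ler_distl binval_cons => /andP[? ?];
      apply/andP; split; lra.
  by move=> a _ /=; rewrite !ler_distl binval_cons => /andP[? ?]; apply/andP; split; lra.
apply: le_trans (ler_wpM2r (joint_ge0 _ _ _ _) m_le_select) _.
have := mulr_ge0 _ (joint_ge0 k.+1 x [set a | `|a - binval (q :: g)| <= r] (g ++ s)).
move=> /(_ (1 - x)); rewrite subr_ge0 => /(_ (ltW x1)).
have := ler_wpM2l (ltW x0) h; lra.
Qed.

(** Write g' = p g t: reject p, select g, reject t, and apply [joint_zeros_ge] to the zeros that
    follow. *)
Lemma joint_infix_ge (g g' : seq bool) r N : infix g g' -> 0 < r -> r * 2 ^+ N <= 2 ->
  m ^+ size g' * (r / 2 * ((1 + x) / 2) ^+ N) <=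
  joint 0 x [set a | `|a - binval g| <= r] (g' ++ nseq N false).
Proof.
move=> /infixP[p [t ->]] r0 rN; have /andP[x0 x1] := hx.
rewrite !size_cat !exprD -!catA -!mulrA.
apply: le_trans (joint_skip_ge 0 _ p _ (measurable_near _ _)).
rewrite ler_pM2l ?exprn_gt0 //.
apply: le_trans (joint_select_ge _ g r _ (ltW r0)).
rewrite ler_pM2l ?exprn_gt0 //.
apply: le_trans (joint_skip_ge _ _ t _ (measurable_near _ _)).
rewrite ler_pM2l ?exprn_gt0 // mulrA.
apply: le_trans (joint_zeros_ge _ r N r0 rN) _; apply: joint_le => //.
by move=> a /andP[a0 _] /= ar; rewrite subr0 ger0_norm.
Qed.

(** * From digit prefixes to zeta(1) *)

Lemma prefix_event_exists k N w : good w ->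
  exists2 s, size s = N & prefix_event k s w.
Proof.
move=> gw; elim: N k => [|N IH] k; first by exists [::].
have [s sN ps] := IH k.+1.
by have [[Qk|Qk] _] := gw k; [exists (false :: s)|exists (true :: s)];
  rewrite /= ?sN.
Qed.

(** At y = 1 every digit is selected, so what remains after the word [s] is a value in [0, 2]
    divided by 2^|s|. *)
Lemma shifted_zeta1_prefix k s w : good w -> prefix_event k s w ->
  0 <= shifted_zeta k 1 w - binval s <= 2 / 2 ^+ size s.
Proof.
move=> gw; elim: s k => [|q s IH] k /=.
  by rewrite binval_nil subr0 expr0 divr1 => _; exact: shifted_zeta_bounds.
move=> [Qk /IH /andP[h0 h2]].
have [_ Uk] := gw k.
rewrite shifted_zeta_step // Uk Qk binval_cons exprS invfM.
by apply/andP; split; lra.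
Qed.

(** On [good], the events measured by [joint 0 x A s] with s in [l] cover [E]. The induction removes
    one of them from [E] at a time. *)
Lemma union_bound (E : set T) A (l : seq (seq bool)) b : measurable E -> measurable A ->
  (forall s, s \in l -> joint 0 x A s <= b) ->
  (forall w, good w -> E w -> A (shifted_zeta 0 x w) /\
     exists2 s, s \in l & prefix_event 0 s w) ->
  fine (P E) <= (size l)%:R * b.
Proof.
move=> mE mA; elim: l E mE => [|s l IH] E mE lb El.
  rewrite mul0r -[leRHS](_ : fine (P set0) = 0); last by rewrite measure0.
  by apply: ae_fine_le => // w gw /(El w gw)[_ []].
have mJ := measurable_joint 0 x A s mA.
rewrite (fine_P_split _ _ mE mJ) /= mulrS mulrDl mul1r; apply: lerD.
  apply: le_trans (lb s _); last by rewrite inE eqxx.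
  by apply: ae_fine_le => //; [exact: measurableI|move=> w _ []].
apply: IH.
- by apply: measurableI => //; exact: measurableC.
- by move=> s' s'l; apply: lb; rewrite inE s'l orbT.
- move=> w gw [Ew nJ]; have [Aw [s' s'l ps']] := El w gw Ew; split => //.
  move: s'l; rewrite inE => /predU1P[s's|s'l]; last by exists s'.
  by exfalso; apply: nJ; split => //; rewrite -s's.
Qed.

(** * Two-sided bounds for the probability of a ball *)

Section ball.
Context (g g' : seq bool).

Definition ball_event (r : R) : set T :=
  [set w | (shifted_zeta 0 x w - binval g) ^+ 2
           + (shifted_zeta 0 1 w - binval g') ^+ 2 <= r ^+ 2].

Lemma measurable_ball_event r : measurable (ball_event r).
Proof.
have mf : measurable_fun setT (fun w => (shifted_zeta 0 x w - binval g) ^+ 2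
    + (shifted_zeta 0 1 w - binval g') ^+ 2).
  by apply: measurable_funD; apply: measurable_funX; apply: measurable_funB => //;
    exact: measurable_shifted_zeta.
rewrite (_ : ball_event r = setT `&` (fun w => (shifted_zeta 0 x w - binval g) ^+ 2
    + (shifted_zeta 0 1 w - binval g') ^+ 2) @^-1` [set a | a <= r ^+ 2]).
  by apply: mf.
by rewrite setTI.
Qed.

(** The factor gained per halving of the radius: 1 / 2 from the length of the interval, (1 + x) / 2
    from one more digit. *)
Let theta : R := (1 + x) / 4.

Let pow_theta N : ((1 + x) / 2) ^+ N = theta ^+ N * 2 ^+ N.
Proof. by rewrite -exprMn; congr (_ ^+ _); rewrite /theta; field. Qed.

(** At most 4 words of length N are possible, each contributing 3 / 2 times the power of theta,
    whence the constant 6. *)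
Lemma ball_event_le N r : 0 < r <= 2^-1 ^+ N -> fine (P (ball_event r)) <= 6 * theta ^+ N.
Proof.
move=> /andP[r0 rN]; have /andP[x0 x1] := hx.
(* The 3 is 1 from the radius of the ball plus 2 from the digits of zeta(1) after the first N. *)
pose W := [set s : N.-tuple bool | (`|binval s - binval g'| <= 3 / 2 ^+ N :> R)%R]%SET.
pose l := [seq tval t | t <- enum W].
have eN : 2^-1 ^+ N = 1 / 2 ^+ N :> R by rewrite exprVn div1r.
have p0 : 0 < 1 / 2 ^+ N :> R by rewrite divr_gt0 ?exprn_gt0.
have e0 : 0 < theta ^+ N by rewrite exprn_gt0 // /theta; lra.
have sl : (size l <= 4)%N by rewrite size_map -cardE card_near_words.
apply: le_trans (_ : (size l)%:R * (3 / 2 * theta ^+ N) <= _); last first.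
  apply: le_trans (_ : 4%:R * (3 / 2 * theta ^+ N) <= _); last lra.
  by apply: ler_wpM2r; [lra|rewrite ler_nat].
apply: (union_bound _ [set a | `|a - binval g| <= 1 / 2 ^+ N]) => //.
- exact: measurable_ball_event.
- move=> _ /mapP[t _ ->]; apply: le_trans (joint_near_le _ _ _ _ p0) _.
  rewrite size_tuple pow_theta le_eqVlt; apply/orP; left; apply/eqP.
  by field; rewrite expf_neq0.
- move=> w gw /= E.
  have near (a b : R) : a ^+ 2 + b ^+ 2 <= r ^+ 2 -> `|a| <= 1 / 2 ^+ N.
    move=> ab; rewrite -eN; apply: le_trans rN.
    rewrite -(@ler_pXn2r _ 2) ?nnegrE ?(ltW r0) // real_normK ?num_real //.
    by have := sqr_ge0 b; lra.
  split; first exact: near E.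
  have {}E : `|shifted_zeta 0 1 w - binval g'| <= 1 / 2 ^+ N.
    by apply: near; rewrite addrC; exact: E.
  have [s sN ps] := prefix_event_exists 0 N w gw.
  exists s => //; apply/mapP.
  have sN' : size s == N by apply/eqP.
  exists (Tuple sN') => //; rewrite mem_enum inE /=.
  have := shifted_zeta1_prefix 0 s w gw ps; rewrite sN => /andP[h1 h2].
  move: E; rewrite !ler_distl => /andP[h3 h4].
  have e2 : 2 / 2 ^+ N = 2 * (1 / 2 ^+ N) :> R by rewrite div1r.
  have e3 : 3 / 2 ^+ N = 3 * (1 / 2 ^+ N) :> R by rewrite div1r.
  by rewrite e2 in h2; rewrite e3; apply/andP; split; lra.
Qed.

(** If the digits start with [g'] and N zeros, and zeta(x) is within 2^-N of its target, the
    coordinates are off by at most r / 4 and r / 2, and 1/16 + 1/4 is below 1. *)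
Lemma ball_event_ge N r : infix g g' -> 2^-1 ^+ N <= r / 4 ->
  m ^+ size g' / 2 * theta ^+ N <= fine (P (ball_event r)).
Proof.
move=> gg' rN; have /andP[x0 x1] := hx.
have p0 : 0 < 2^-1 ^+ N :> R by rewrite exprn_gt0.
have pN : 2^-1 ^+ N * 2 ^+ N = 1 :> R by rewrite -exprMn mulVf // expr1n.
apply: le_trans (_ : joint 0 x [set a | `|a - binval g| <= 2^-1 ^+ N]
    (g' ++ nseq N false) <= _).
  apply: le_trans (joint_infix_ge g g' _ N gg' p0 _); last by rewrite pN ler1n.
  rewrite pow_theta le_eqVlt; apply/orP; left; apply/eqP.
  transitivity (m ^+ size g' / 2 * theta ^+ N * (2^-1 ^+ N * 2 ^+ N)); last by ring.
  by rewrite pN mulr1.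
apply: ae_fine_le; [exact: measurable_joint|exact: measurable_ball_event|].
move=> w gw [/=]; rewrite ler_distl => /andP[h1 h2] ps.
have /andP[h3] := shifted_zeta1_prefix 0 _ w gw ps.
(* The zeros leave the value of the word unchanged and make its length at least N, so zeta(1)
   exceeds its target by at most 2 / 2^N. *)
rewrite binval_cat0 in h3 *; rewrite size_cat size_nseq => h4.
have {}h4 : shifted_zeta 0 1 w - binval g' <= 2 * 2^-1 ^+ N.
  apply: le_trans h4 _; rewrite exprVn ler_pM2l // lef_pV2 ?posrE ?exprn_gt0 //.
  by rewrite ler_eXn2l ?ltr1n // leq_addl.
pose a := shifted_zeta 0 x w - binval g; pose b := shifted_zeta 0 1 w - binval g'.
have ha : a ^+ 2 <= (r / 4) ^+ 2.
  rewrite -[a ^+ 2]real_normK ?num_real // ler_pXn2r ?nnegrE //; last lra.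
  by rewrite ler_norml /a; apply/andP; split; lra.
have hb : b ^+ 2 <= (r / 2) ^+ 2 by rewrite ler_pXn2r ?nnegrE /b //; lra.
move: ha hb; rewrite /ball_event /= -/a -/b !exprMn !expr2.
by have := sqr_ge0 r; rewrite expr2; lra.
Qed.

End ball.
End fixed_x.
End process.

(** * Passage from the ball estimates to the local dimension *)

Theorem theorem7p1 (d : measure_display) (T : measurableType d) (R : realType)
  (P : probability T R) (Q U : nat -> T -> R)
  (mQ : forall n, measurable_fun setT (Q n))
  (mU : forall n, measurable_fun setT (U n))
  (indep : mutually_independent P
             (fun i : nat + nat => match i with inl n => Q n | inr n => U n end))
  (hQ0 : forall n, P (Q n @^-1` [set 0]) = (2^-1)%:E)
  (hQ1 : forall n, P (Q n @^-1` [set 1]) = (2^-1)%:E)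
  (hU : forall n (B : set R), measurable B ->
          P (U n @^-1` B) = lebesgue_measure (B `&` `[0, 1]))
  (x : R) (hx : 0 < x < 1)
  (g g' : seq bool) (hg : (0 < size g)%N) (hsub : infix g g') :
  (fun r : R =>
     ln (fine (P [set w | (zeta Q U x w - binval g) ^+ 2
                          + (zeta Q U 1 w - binval g') ^+ 2 <= r ^+ 2]))
     / ln r) @ 0^'+ --> 2 - ln (1 + x) / ln 2.
Proof.
have /andP[x0 x1] := hx.
have shift0 y : zeta Q U y = shifted_zeta Q U 0 y.
  rewrite /shifted_zeta; congr (zeta _ _ _);
    by apply/funext => n; rewrite addn0.
rewrite !shift0.
pose theta : R := (1 + x) / 4.
have t0 : 0 < theta by rewrite /theta; lra.
have -> : 2 - ln (1 + x) / ln 2 = - ln theta / ln 2.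
  have l2 : ln 2 != 0 :> R by rewrite gt_eqF // ln_gt0 // ltr1n.
  have -> : theta = (1 + x) * 2^-1 ^+ 2 by rewrite /theta; field.
  rewrite lnM ?posrE ?exprn_gt0 //; last lra.
  by rewrite lnXn // lnV ?posrE // mulr2n; field.
pose m := x * (1 - x) / 2.
have m0 : 0 < m by rewrite divr_gt0 // mulr_gt0 // subr_gt0.
apply: (@cvg_ln_ratio _ (fun r => fine (P (ball_event Q U x g g' r)))
  (m ^+ size g' / 2 * theta ^+ 3) 6 theta).
- by rewrite mulr_gt0 ?exprn_gt0 // divr_gt0 // exprn_gt0.
- by [].
- by rewrite t0 /=; rewrite /theta; lra.
move=> N r /andP[r1 r2]; apply/andP; split.
  (* The lower bound is used at N + 3, because 2^-(N+3) is a quarter of 2^-(N+1), which is below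
     [r]; this is the source of [theta ^+ 3] in the constant. *)
  rewrite -mulrA -exprD addnC.
  apply: (ball_event_ge P Q U mQ mU indep hQ0 hQ1 hU x hx g g' (N + 3) r hsub).
  have : 2^-1 ^+ (N + 3) = 2^-1 ^+ N.+1 / 4 :> R.
    by rewrite exprD (exprS _ N); field.
  have : 0 < 2^-1 ^+ N.+1 :> R by rewrite exprn_gt0.
  lra.
apply: (ball_event_le P Q U mQ mU indep hQ0 hQ1 hU x hx g g' N r).
by rewrite r2 andbT (lt_trans _ r1) // exprn_gt0.
Qed.
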